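(* Let $p\ge 2$. Let $f:(\mathbb{R},0)\to\mathbb{R}^{1+p}$ be a frontal curve-germ (with a fixed Legendrian lift) without inflection point, and suppose that its tangent map $\mathrm{Tan}(f):(\mathbb{R},0)\times\mathbb{R}\to\mathbb{R}^{1+p}$ is a proper frontal. Let $\tau,\mu,\nu_1,\dots,\nu_{p-1}$ be the frame, and $\kappa$, $\ell_1,\dots,\ell_{p-1}$ the curvature and torsion functions, described in the context. Then, for any $u_1,\dots,u_{p-1}\in\mathbb{R}$, with $\nu=\sum_{i=1}^{p-1}u_i\nu_i$, the parallel $\mathrm{Pal}_\nu(\mathrm{Tan}(f))$ to $\mathrm{Tan}(f)$ is right equivalent to the tangent map $\mathrm{Tan}(g)$ of a frontal curve $g:(\mathbb{R},0)\to\mathbb{R}^{1+p}$ (taken with a suitable Legendrian lift of $g$). In fact $g$ is given by $$g(t)=f(t)+\sum_{i=1}^{p-1}u_i\left(\frac{\ell_i(t)}{\kappa(t)}\,\tau(t)+\nu_i(t)\right).$$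
   Context: All manifolds and maps are $C^\infty$. Tangent spaces $T_x\mathbb{R}^{m}$ are identified with $\mathbb{R}^m$ with its Euclidean inner product. Frontal: for an $m$-dimensional manifold $U$, a map-germ $h:(U,a)\to\mathbb{R}^{m+q}$ is a frontal if there is a smooth family $t\mapsto\widetilde h(t)\subset T_{h(t)}\mathbb{R}^{m+q}$ of $m$-dimensional linear subspaces along $h$ (a Legendrian lift) with $h_*(T_tU)\subseteq\widetilde h(t)$. A map $h:U\to\mathbb{R}^{m+q}$ is a frontal if its germ at every point is a frontal. Given a Legendrian lift over $U$, the tangent bundle $T_h$ has fibres $T_{h,t}=\widetilde h(t)$ and the normal bundle $N_h$ has fibres $N_{h,t}=\widetilde h(t)^\perp$. A map(-germ) $h$ from an $m$-manifold is proper if its singular locus $\{t:\operatorname{rank}(T_th)<m\}$ has no interior point; a proper frontal has a unique Legendrian lift. Notation: a map on $(\mathbb{R},0)\times\mathbb{R}$ means a map on $I\times\mathbb{R}$ for some open interval $I\ni 0$ (which may be shrunk). Tangent map: if $f:(\mathbb{R},0)\to\mathbb{R}^{1+p}$ is a frontal curve with Legendrian lift spanned by a smooth unit vector field $\tau(t)$ (a unit frame of $T_f$), then $\mathrm{Tan}(f)(t,s)=f(t)+s\tau(t)$. Inflection point: $t_0$ is an inflection point of $f$ if there exists a unit frame $\tau$ of $T_f$, regarded as a curve in the unit sphere $S^p$, with $\tau'(t_0)=0$. Frame, curvature and torsion: suppose $F=\mathrm{Tan}(f)$ is a proper frontal, and let $T_F$ (rank $2$) and $N_F$ (rank $p-1$)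 be its tangent and normal bundles. Let $\tau$ be a unit frame of $T_f$, regarded as a section of $T_F$ along $I\times\{0\}$, and take $\mu$ such that $\{\tau,\mu\}$ is an orthonormal frame of $T_F$ along $I\times\{0\}$. There is a unique function $\kappa:I\to\mathbb{R}$ (curvature function) with $\tau'(t)=\kappa(t)\mu(t)$. Let $\{\nu_1,\dots,\nu_{p-1}\}$ be a normally parallel orthonormal frame of $N_F$ along $I\times\{0\}$, i.e. a smooth orthonormal frame such that $\nu_i'(t)\in T_{F,(t,0)}$ for all $i$ and $t$. There are unique functions $\ell_1,\dots,\ell_{p-1}:I\to\mathbb{R}$ (torsion functions) with $\mu'(t)=-\kappa(t)\tau(t)+\sum_{i=1}^{p-1}\ell_i(t)\nu_i(t)$. The frame is extended over $I\times\mathbb{R}$ by $\nu_i(t,s)=\nu_i(t)$, using that $N_F$ is constant along each $\{t\}\times\mathbb{R}$; it is then a normally parallel orthonormal frame of $N_F$. Parallel: for constants $u_1,\dots,u_{p-1}\in\mathbb{R}$ and $\nu=\sum_i u_i\nu_i$, $\mathrm{Pal}_\nu(\mathrm{Tan}(f))(t,s)=\mathrm{Tan}(f)(t,s)+\sum_{i=1}^{p-1}u_i\nu_i(t)$. Right equivalence: two maps $P,Q:(\mathbb{R},0)\times\mathbb{R}\to\mathbb{R}^{1+p}$ are right equivalent if $P=Q\circ\varphi$ for some diffeomorphism $\varphi$ of $(\mathbb{R},0)\times\mathbb{R}$. *)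

(* Defs.v *)
(* MathComp-Analysis; Euclidean n-space is 'rV[R]_n. *)
From HB Require Import structures.
From mathcomp Require Import all_boot all_order all_algebra.
From mathcomp Require Import all_classical all_reals all_analysis.

Set Implicit Arguments.
Unset Strict Implicit.
Unset Printing Implicit Defensive.

Import Order.TTheory GRing.Theory Num.Theory.
Import numFieldNormedType.Exports.

Local Open Scope classical_set_scope.
Local Open Scope ring_scope.

Section Euclidean.
Context {R : realType} {n : nat}.

(* The library norm on 'rV[R]_n is the sup norm (same topology), so Euclidean
   notions go through this inner product. *)
Definition dot (x y : 'rV[R]_n) : R := \sum_(i < n) x 0 i * y 0 i.

Definition orthonormal (k : nat) (e : 'I_k -> 'rV[R]_n) : Prop :=
  forall i j, dot (e i) (e j) = (i == j)%:R.

Definition orthogonal_complement (W : {vspace 'rV[R]_n}) : set 'rV[R]_n :=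
  [set x | forall w, w \in W -> dot x w = 0].

End Euclidean.

Section Frontals.
Context {R : realType}.

(* C^infinity on an open set U: all iterated directional derivatives exist and
   are differentiable on U. This is the usual notion when V is
   finite-dimensional; V is R or 'rV[R]_m below. *)
Definition smooth_on (V W : normedModType R) (U : set V) (h : V -> W) : Prop :=
  forall (vs : seq V) (x : V), U x ->
    differentiable (foldr (fun v g => 'D_v g) h vs) x.

(* Smoothness of a family of m-dimensional subspaces is expressed by local
   smooth frames. *)
Definition smooth_subspaces (V : normedModType R) (n m : nat) (U : set V)
    (H : V -> {vspace 'rV[R]_n}) : Prop :=
  forall a, U a -> exists (U' : set V) (e : 'I_m -> V -> 'rV[R]_n),
    [/\ open_nbhs a U', U' `<=` U, (forall i, smooth_on U' (e i)) &
        forall t, U' t -> basis_of (H t) (codom (e^~ t))].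

(* m stands for the dimension of V. *)
Definition legendrian_lift (V : normedModType R) (n m : nat) (U : set V)
    (h : V -> 'rV[R]_n) (H : V -> {vspace 'rV[R]_n}) : Prop :=
  [/\ smooth_on U h, smooth_subspaces m U H &
      forall t v, U t -> 'd h t v \in H t].

Definition frontal_germ (V : normedModType R) (n m : nat) (a : V)
    (h : V -> 'rV[R]_n) : Prop :=
  exists (U : set V) (H : V -> {vspace 'rV[R]_n}),
    open_nbhs a U /\ legendrian_lift m U h H.

Definition frontal (V : normedModType R) (n m : nat) (U : set V)
    (h : V -> 'rV[R]_n) : Prop :=
  forall a, U a -> frontal_germ m a h.

Definition singular_locus (m n : nat) (U : set 'rV[R]_m)
    (h : 'rV[R]_m -> 'rV[R]_n) : set 'rV[R]_m :=
  [set t | U t /\ (\rank ('J h t) < m)%N].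

Definition proper_map (m n : nat) (U : set 'rV[R]_m)
    (h : 'rV[R]_m -> 'rV[R]_n) : Prop :=
  interior (singular_locus U h) = set0.

End Frontals.

Section TangentMaps.
Context {R : realType} {n : nat}.

(* A point (t, s) of the plane is the row vector with entries t and s. *)
Definition pair2 (t s : R) : 'rV[R]_2 :=
  \row_(j < 2) (if j == 0 then t else s).

Definition strip (I : set R) : set 'rV[R]_2 := [set x | I (x 0 0)].

Definition unit_frame (I : set R) (T : R -> {vspace 'rV[R]_n})
    (tau : R -> 'rV[R]_n) : Prop :=
  smooth_on I tau /\
  forall t, I t -> dot (tau t) (tau t) = 1 /\ T t = <[tau t]>%VS.

Definition inflection_point (I : set R) (T : R -> {vspace 'rV[R]_n})
    (t0 : R) : Prop :=
  exists tau : R -> 'rV[R]_n, unit_frame I T tau /\ derive1 tau t0 = 0.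

Definition Tan (f tau : R -> 'rV[R]_n) : 'rV[R]_2 -> 'rV[R]_n :=
  fun x => f (x 0 0) + x 0 1 *: tau (x 0 0).

Definition Pal (nu F : 'rV[R]_2 -> 'rV[R]_n) : 'rV[R]_2 -> 'rV[R]_n :=
  fun x => F x + nu x.

Definition orthonormal_tangent_frame (I : set R)
    (TF : 'rV[R]_2 -> {vspace 'rV[R]_n}) (tau mu : R -> 'rV[R]_n) : Prop :=
  [/\ smooth_on I tau, smooth_on I mu &
      forall t, I t ->
        [/\ dot (tau t) (tau t) = 1, dot (mu t) (mu t) = 1,
            dot (tau t) (mu t) = 0 &
            TF (pair2 t 0) = <<[:: tau t; mu t]>>%VS]].

(* The normal bundle has fibres the orthogonal complements of those of TF. *)
Definition normally_parallel_frame (k : nat) (I : set R)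
    (TF : 'rV[R]_2 -> {vspace 'rV[R]_n}) (nu : 'I_k -> R -> 'rV[R]_n) : Prop :=
  (forall i, smooth_on I (nu i)) /\
  forall t, I t ->
    [/\ orthonormal (nu^~ t),
        orthogonal_complement (TF (pair2 t 0)) =
          [set x | x \in <<codom (nu^~ t)>>%VS] &
        forall i, derive1 (nu i) t \in TF (pair2 t 0)].

Definition strip_diffeomorphism (I : set R) (phi : 'rV[R]_2 -> 'rV[R]_2)
    : Prop :=
  exists psi : 'rV[R]_2 -> 'rV[R]_2,
    [/\ smooth_on (strip I) phi, smooth_on (strip I) psi &
        forall x, strip I x ->
          [/\ strip I (phi x), strip I (psi x), psi (phi x) = x &
              phi (psi x) = x]].

(* phi is moreover required to preserve {0} x R, so that it is a
   diffeomorphism of germs along {0} x R and not only one of strips. *)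
Definition right_equivalent (I : set R) (P Q : 'rV[R]_2 -> 'rV[R]_n) : Prop :=
  exists phi : 'rV[R]_2 -> 'rV[R]_2,
    [/\ strip_diffeomorphism I phi,
        (forall x, strip I x -> phi x 0 0 = 0 <-> x 0 0 = 0) &
        forall x, strip I x -> P x = Q (phi x)].

End TangentMaps.

(* Main.v *)
(* Put [a := sum_i u_i l_i / kappa], so that [g = f + a tau + sum_i u_i nu_i].
   Since [nu_i'] lies in the span of [tau] and [mu] and [nu_i . mu = 0], we have
   [nu_i' + l_i mu] parallel to [tau]; with [a tau' = a kappa mu] the mu-parts of
   [g'] cancel, so [g'] is parallel to [tau] and the Legendrian lift of [f] is one
   of [g]. Both [Pal_nu (Tan f)] and [Tan g] are then parametrized along the same
   lines, and differ by the shear [(t, s) |-> (t, s - a t)]. The coefficient [a] is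
   smooth because [kappa = tau' . mu] does not vanish in the absence of inflection
   points and [l_i = mu' . nu_i]. *)
Require Import Defs.
From HB Require Import structures.
From mathcomp Require Import all_boot all_order all_algebra.
From mathcomp Require Import all_classical all_reals all_analysis.

Set Implicit Arguments.
Unset Strict Implicit.
Unset Printing Implicit Defensive.

Import Order.TTheory GRing.Theory Num.Theory.
Import numFieldNormedType.Exports.

Local Open Scope classical_set_scope.
Local Open Scope ring_scope.

(** * Finite differentiability classes and their relation to smoothness *)

Section SmoothnessClasses.
Context {R : realType} {V W : normedModType R}.
Implicit Types (U : set V) (h : V -> W).

(** Near [x] the two maps have the same increments, so the first-order expansion of [f] with
    ['d f x] is also one of [g]; uniqueness of the differential then identifies ['d g x] with
    ['d f x]. *)
Lemma near_eq_differentiable (f g : V -> W) (x : V) :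
  {near x, f =1 g} -> differentiable f x -> differentiable g x.
Proof.
move=> fg df.
suff dg : g \o shift x = cst (g x) + 'd f x +o_ 0 id.
  apply/diff_locallyP.
  rewrite (diff_unique (diff_continuous df) dg); split=> //.
  exact: diff_continuous.
have fgx : f x = g x by exact: nbhs_singleton fg.
apply/eqaddoP => eps eps0.
have /eqaddoP/(_ _ eps0) He := diff_locally df.
have fg0 : \forall y \near (0 : V), f (y + x) = g (y + x).
  move: fg; rewrite (near_shift 0) /=; apply: filterS => y.
  by rewrite /= subr0.
near=> y.
have -> : (g \o shift x - (cst (g x) + 'd f x)) y =
    (f \o shift x - (cst (f x) + 'd f x)) y.
  rewrite !fctE /= fgx; congr (_ - _); symmetry.
  by near: y; move: fg0; apply: filterS.
by near: y.
Unshelve. all: by end_near. Qed.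

(* Grading by [k] turns closure of smooth maps under an operation into an
   induction through its Leibniz or chain rule. *)
Fixpoint class_C (U : set V) (k : nat) (h : V -> W) : Prop :=
  (forall x, U x -> differentiable h x) /\
  if k is k'.+1 then forall v, class_C U k' ('D_v h) else True.

Lemma class_C_differentiable U k h x :
  class_C U k h -> U x -> differentiable h x.
Proof. by case: k => [|k] [dh _]; exact: dh. Qed.

(** In the [foldr] of [smooth_on] the last direction of the list is the one differentiated first, so
    passing from [h] to ['D_v h] means appending [v] with [rcons]. *)
Lemma smooth_onP U h : smooth_on U h <-> forall k, class_C U k h.
Proof.
split=> [sh k|ch vs x Ux].
  elim: k h sh => [|k IH] h sh; split=> //; try exact: (sh [::]).
  move=> v; apply: IH => vs x Ux.
  by have := sh (rcons vs v) x Ux; rewrite foldr_rcons.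
elim/last_ind: vs h ch => [|vs v IH] h ch /=.
  exact: class_C_differentiable (ch 0) Ux.
by rewrite foldr_rcons; apply: IH => k; case: (ch k.+1) => _; apply.
Qed.

Lemma class_CW U k h : class_C U k.+1 h -> class_C U k h.
Proof.
elim: k h => [|k IH] h [dh ch]; split=> // v.
by apply: IH; exact: ch.
Qed.

(** Since [U] is open, equality on [U] holds near each of its points and passes to directional
    derivatives. This allows a derivative to be replaced by a Leibniz or chain rule formula valid
    only on [U]. *)
Lemma eq_class_C U k (h g : V -> W) : open U -> (forall x, U x -> h x = g x) ->
  class_C U k h -> class_C U k g.
Proof.
move=> oU; elim: k h g => [|k IH] h g hg [dh ch]; split=> //.
- move=> x Ux; apply: near_eq_differentiable (dh x Ux).
  by have := open_nbhs_nbhs (conj oU Ux); apply: filterS.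
- move=> x Ux; apply: near_eq_differentiable (dh x Ux).
  by have := open_nbhs_nbhs (conj oU Ux); apply: filterS.
move=> v; apply: IH (ch v) => x Ux; apply: near_eq_derive.
by have := open_nbhs_nbhs (conj oU Ux); apply: filterS.
Qed.

End SmoothnessClasses.

(** * Sums, and the differential of a scalar multiple *)

Section LinearCombinations.
Context {R : realType} {V W : normedModType R} (U : set V).
Hypothesis oU : open U.

Lemma class_C_cst k (c : W) : class_C U k (cst c).
Proof.
elim: k c => [|k IH] c; split=> // v.
by apply: eq_class_C (IH 0) => // x _; rewrite derive_cst.
Qed.

Lemma class_CD k (h g : V -> W) :
  class_C U k h -> class_C U k g -> class_C U k (h + g).
Proof.
elim: k h g => [|k IH] h g [dh ch] [dg cg];
  have dhg x (Ux : U x) := differentiableD (dh x Ux) (dg x Ux); split.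
- exact: dhg.
- by [].
- exact: dhg.
move=> v; apply: eq_class_C (IH _ _ (ch v) (cg v)) => // x Ux.
by rewrite deriveD //; apply: diff_derivable; [exact: dh | exact: dg].
Qed.

(** Scaling is a continuous bilinear map, and the product is its composite with the pair of [h] and
    [g]. *)
Lemma is_diff_scale (h : V -> R) (g : V -> W) x :
  differentiable h x -> differentiable g x ->
  is_diff x (fun y => h y *: g y)
    (fun v => h x *: 'd g x v + 'd h x v *: g x).
Proof.
move=> dh dg.
have bl : bilinear_for
  (GRing.Scale.Law.clone _ _ *:%R _) (GRing.Scale.Law.clone _ _ *:%R _)
  (fun (k : R) (w : W) => k *: w).
  split=> [u'|u] a y z /=; first by rewrite scalerDl scalerA.
  by rewrite scalerDr !scalerA mulrC.
(* Scaling is packed as a bilinear map so that [diff_bilin] applies to it. *)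
pose blM := bilinear_isBilinear.Build R R W W _ _ (fun (k : R) (w : W) => k *: w) bl.
pose B : {bilinear R -> W -> W} := HB.pack (fun (k : R) (w : W) => k *: w) blM.
have cB : continuous (fun p => B p.1 p.2) by move=> p; exact: scale_continuous.
have dB := differentiable_bilin (f := B) (h x, g x) cB.
have dp := differentiable_pair dh dg.
have -> : (fun y => h y *: g y) =
  (fun p => B p.1 p.2) \o (fun y => (h y, g y)) by [].
apply: DiffDef; first exact: differentiable_comp.
by rewrite diff_comp // diff_bilin // diff_pair.
Qed.

End LinearCombinations.

Section Products.
Context {R : realType} {V W : normedModType R} (U : set V).
Hypothesis oU : open U.

(** By the Leibniz rule each term of the derivative has one differentiated factor of class [k]; the
    other factor is lowered to class [k] by [class_CW], and induction applies. *)
Lemma class_CZ k (h : V -> R) (g : V -> W) :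
  class_C U k h -> class_C U k g -> class_C U k (fun x => h x *: g x).
Proof.
elim: k h g => [|k IH] h g ch0 cg0;
  have [dh ch] := ch0; have [dg cg] := cg0;
  have dhg x (Ux : U x) := @ex_diff _ _ _ _ _ _ _
    (is_diff_scale (dh x Ux) (dg x Ux)); split.
- exact: dhg.
- by [].
- exact: dhg.
move=> v; have cDhg := IH _ _ (ch v) (class_CW cg0).
have := class_CD oU (IH _ _ (class_CW ch0) (cg v)) cDhg.
apply: eq_class_C => // x Ux; have df := is_diff_scale (dh x Ux) (dg x Ux).
rewrite !deriveE ?diff_val // fctE !deriveE //; [exact: dh | exact: dg].
Qed.

End Products.

Lemma derive_scale (R : realType) (V W : normedModType R) (k : V -> R)
    (h : V -> W) (x v : V) : differentiable k x -> differentiable h x ->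
  'D_v (fun y => k y *: h y) x = k x *: 'D_v h x + 'D_v k x *: h x.
Proof.
move=> dk dh; have df := is_diff_scale dk dh.
by rewrite !deriveE // diff_val.
Qed.

(** * Reciprocals, and composition with linear maps on either side *)

Section Compositions.
Context {R : realType}.

(** The derivative of [1/h] is [- (1/h) (1/h) 'D_v h], in which [1/h] is needed only one class
    lower, as induction provides. *)
Lemma class_CV (V : normedModType R) (U : set V) k (h : V -> R) : open U ->
  (forall x, U x -> h x != 0) ->
  class_C U k h -> class_C U k (fun x => (h x)^-1).
Proof.
move=> oU h0; elim: k => [|k IH] ch0; have [dh ch] := ch0; split=> //;
  try by move=> x Ux; apply: differentiableV; [exact: dh | exact: h0].
move=> v; have cI := IH (class_CW ch0).
have cm := class_CZ oU (class_C_cst oU k (-1 : R))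
  (class_CZ oU cI (class_CZ oU cI (ch v))).
apply: eq_class_C cm => // x Ux.
rewrite deriveV; [|exact: h0|exact/diff_derivable/dh].
by rewrite !scalerA mulN1r mulNr expr2 invfM.
Qed.

(** Directional derivatives commute with [L]: the derivative of [L \o h] is [L \o 'D_v h]. *)
Lemma class_C_linear (V W W' : normedModType R) (U : set V)
    (L : {linear W -> W'}) k (h : V -> W) : open U -> continuous L ->
  class_C U k h -> class_C U k (L \o h).
Proof.
move=> oU cL; elim: k h => [|k IH] h [dh ch]; split=> //;
  try by move=> x Ux; apply: differentiable_comp;
    [exact: dh | exact: linear_differentiable].
move=> v; apply: eq_class_C (IH _ (ch v)) => // x Ux.
have dL := linear_differentiable (h x) cL.
have dhx := dh x Ux.
rewrite (deriveE v (differentiable_comp dhx dL)) (diff_comp dhx dL).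
by rewrite (diff_lin _ cL) /= (deriveE v dhx).
Qed.

(** The derivative along [v] is the constant [L v] times ['D_1 h \o L]. With [L] the first
    coordinate, this turns smooth functions of [t] into smooth functions on the strip. *)
Lemma class_C_precomp (V W : normedModType R) (I : set R) (L : {linear V -> R})
    k (h : R -> W) : open I -> continuous L ->
  class_C I k h -> class_C (L @^-1` I) k (h \o L).
Proof.
move=> oI cL.
have oU : open (L @^-1` I) by apply: open_comp => // x _; exact: cL.
elim: k h => [|k IH] h [dh ch]; split=> //;
  try by move=> x Ux; apply: differentiable_comp;
    [exact: linear_differentiable | exact: dh].
move=> v.
have cm := class_CZ oU (class_C_cst oU k (L v : R)) (IH _ (ch 1)).
apply: eq_class_C cm => // x Ux.
have dL := linear_differentiable x cL.
have dhL : differentiable h (L x) by exact: dh.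
rewrite (deriveE v (differentiable_comp dL dhL)) (diff_comp dL dhL).
rewrite (diff_lin _ cL) /= (deriveE _ dhL) -linearZ.
by congr ('d h (L x) _); exact: mulr1.
Qed.

End Compositions.

(** * Closure properties of smooth maps on an open set *)

Section Smooth.
Context {R : realType} {V W : normedModType R} (U : set V).
Hypothesis oU : open U.
Implicit Types (h : V -> W).

Lemma smooth_on_differentiable h x : smooth_on U h -> U x -> differentiable h x.
Proof. by move=> /(_ [::]); apply. Qed.

Lemma smooth_on_derivable h x v : smooth_on U h -> U x -> derivable h x v.
Proof. by move=> sh Ux; exact/diff_derivable/smooth_on_differentiable. Qed.

Lemma smooth_on_derive v h : smooth_on U h -> smooth_on U ('D_v h).
Proof.
by move=> /smooth_onP sh; apply/smooth_onP => k; have [_] := sh k.+1; exact.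
Qed.

Lemma eq_smooth_on (h g : V -> W) : (forall x, U x -> h x = g x) ->
  smooth_on U h -> smooth_on U g.
Proof.
by move=> hg /smooth_onP sh; apply/smooth_onP => k; exact: eq_class_C (sh k).
Qed.

Lemma smooth_on_cst (c : W) : smooth_on U (cst c).
Proof. by apply/smooth_onP => k; exact: class_C_cst. Qed.

Lemma smooth_onD h g : smooth_on U h -> smooth_on U g ->
  smooth_on U (fun x => h x + g x).
Proof.
move=> /smooth_onP sh /smooth_onP sg; apply/smooth_onP => k.
exact: (class_CD oU (sh k) (sg k)).
Qed.

Lemma smooth_on_sum n (h : 'I_n -> V -> W) :
  (forall i, smooth_on U (h i)) -> smooth_on U (fun x => \sum_(i < n) h i x).
Proof.
move=> sh.
suff H (s : seq 'I_n) : smooth_on U (fun x => \sum_(i <- s) h i x) by exact: H.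
elim: s => [|i s IH].
  by apply: eq_smooth_on (smooth_on_cst 0) => x _; rewrite big_nil.
by apply: eq_smooth_on (smooth_onD (sh i) IH) => x _; rewrite big_cons.
Qed.

Lemma smooth_onZ (k : V -> R) h : smooth_on U k -> smooth_on U h ->
  smooth_on U (fun x => k x *: h x).
Proof.
move=> /smooth_onP sk /smooth_onP sh; apply/smooth_onP => n.
exact: (class_CZ oU (sk n) (sh n)).
Qed.

Lemma smooth_onV (h : V -> R) : (forall x, U x -> h x != 0) ->
  smooth_on U h -> smooth_on U (fun x => (h x)^-1).
Proof.
by move=> h0 /smooth_onP sh; apply/smooth_onP => k; exact: class_CV (sh k).
Qed.

Lemma smooth_on_linear (L : {linear V -> W}) : continuous L -> smooth_on U L.
Proof.
move=> cL; apply/smooth_onP => -[|k]; split=> //;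
  try by move=> x _; exact: linear_differentiable.
move=> v; apply: eq_class_C (class_C_cst oU k (L v)) => // x _.
by rewrite deriveE ?diff_lin //; exact: linear_differentiable.
Qed.

Lemma smooth_on_linear_comp (W' : normedModType R) (L : {linear W -> W'}) h :
  continuous L -> smooth_on U h -> smooth_on U (L \o h).
Proof.
by move=> cL /smooth_onP sh; apply/smooth_onP => k; exact: class_C_linear.
Qed.

Lemma smooth_on_precomp (I : set R) (L : {linear V -> R}) (h : R -> W) :
  open I -> continuous L -> smooth_on I h -> smooth_on (L @^-1` I) (h \o L).
Proof.
by move=> oI cL /smooth_onP sh; apply/smooth_onP => k; exact: class_C_precomp.
Qed.

End Smooth.

(** * Bilinearity, smoothness and Leibniz rule of the inner product *)

Section Euclidean.
Context {R : realType} {n : nat}.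
Implicit Types x y z : 'rV[R]_n.

Lemma dotC x y : dot x y = dot y x.
Proof. by apply: eq_bigr => i _; rewrite mulrC. Qed.

Lemma dotDl x y z : dot (x + y) z = dot x z + dot y z.
Proof. by rewrite -big_split; apply: eq_bigr => i _; rewrite mxE mulrDl. Qed.

Lemma dotZl (a : R) x y : dot (a *: x) y = a * dot x y.
Proof. by rewrite /dot mulr_sumr; apply: eq_bigr => i _; rewrite mxE mulrA. Qed.

Lemma dot0l y : dot 0 y = 0.
Proof. by rewrite -(scale0r 0) dotZl mul0r. Qed.

Lemma dot_suml m (x : 'I_m -> 'rV[R]_n) y :
  dot (\sum_(i < m) x i) y = \sum_(i < m) dot (x i) y.
Proof. by apply: (big_morph (dot^~ y)) => [a b|]; rewrite ?dotDl ?dot0l. Qed.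

(** A named coordinate function can carry a linear structure, as the lemmas on composition with
    linear maps require. *)
Definition row_coord (i : 'I_n) (x : 'rV[R]_n) : R := x 0 i.

Fact row_coord_is_linear i : linear (row_coord i).
Proof. by move=> a x y; rewrite /row_coord !mxE. Qed.

HB.instance Definition _ i :=
  GRing.isLinear.Build R 'rV[R]_n R _ (row_coord i) (row_coord_is_linear i).

Lemma row_coord_continuous i : continuous (row_coord i).
Proof. exact: coord_continuous. Qed.

Lemma smooth_on_dot (V : normedModType R) (U : set V) (f g : V -> 'rV[R]_n) :
  open U -> smooth_on U f -> smooth_on U g ->
  smooth_on U (fun t => dot (f t) (g t)).
Proof.
move=> oU sf sg; apply: smooth_on_sum => // i.
have sc (h : V -> 'rV[R]_n) : smooth_on U h -> smooth_on U (row_coord i \o h).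
  exact/smooth_on_linear_comp/row_coord_continuous.
exact: smooth_onZ (sc _ sf) (sc _ sg).
Qed.

Lemma derive_dot (V : normedModType R) (f g : V -> 'rV[R]_n) (t v : V) :
  derivable f t v -> derivable g t v ->
  'D_v (fun s => dot (f s) (g s)) t =
    dot ('D_v f t) (g t) + dot (f t) ('D_v g t).
Proof.
move=> df dg.
have df' i : derivable (fun s => f s 0 i) t v by move: df => /derivable_mxP; exact.
have dg' i : derivable (fun s => g s 0 i) t v by move: dg => /derivable_mxP; exact.
have -> : (fun s => dot (f s) (g s)) =
    \sum_(i < n) ((fun s => f s 0 i) * (fun s => g s 0 i)).
  by apply/funext => s; rewrite fct_sumE.
rewrite derive_sum; last by move=> i; exact: derivableM.
rewrite -big_split; apply: eq_bigr => i _.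
by rewrite deriveM // (derive_mx df) (derive_mx dg) !mxE addrC mulrC.
Qed.

End Euclidean.

(** * Coordinates on the strip and its shears along the lines of constant [t] *)

Section Strip.
Context {R : realType}.

Lemma pair2E (t s : R) : pair2 t s = t *: pair2 1 0 + s *: pair2 0 1.
Proof.
apply/rowP => j; rewrite !mxE.
by case: ifP => _; rewrite ?mulr1 ?mulr0 ?addr0 ?add0r.
Qed.

Lemma pair2_coord (x : 'rV[R]_2) : pair2 (x 0 0) (x 0 1) = x.
Proof.
apply/rowP => j; rewrite mxE; case: ifP => [/eqP -> //|].
by case: j => -[|[|//]] //= ? _; congr (x _ _); exact: val_inj.
Qed.

Lemma open_strip (I : set R) : open I -> open (strip I).
Proof.
move=> oI; apply: (open_comp (f := row_coord 0)) => // x _.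
exact: row_coord_continuous.
Qed.

Lemma smooth_on_strip_shear (I : set R) (a : R -> R) :
  open I -> smooth_on I a ->
  smooth_on (strip I) (fun x : 'rV[R]_2 => pair2 (x 0 0) (x 0 1 + a (x 0 0))).
Proof.
move=> oI sa; have oS := open_strip oI.
have sc (j : 'I_2) : smooth_on (strip I) (row_coord (R := R) j).
  by apply: smooth_on_linear => //; exact: row_coord_continuous.
have sax : smooth_on (strip I) (a \o row_coord (R := R) 0).
  by apply: smooth_on_precomp => //; exact: row_coord_continuous.
apply: (@eq_smooth_on _ _ _ _ oS (fun x => row_coord 0 x *: pair2 1 0 +
   (row_coord 1 x + a (row_coord 0 x)) *: pair2 0 1)).
  by move=> x _; rewrite [RHS]pair2E.
apply: smooth_onD => //; apply: smooth_onZ => //; try exact: smooth_on_cst.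
exact: smooth_onD.
Qed.

(** The inverse is the shear with the opposite sign, and both fix the first coordinate. *)
Lemma strip_diffeomorphism_shear (I : set R) (a : R -> R) :
  open I -> smooth_on I a ->
  strip_diffeomorphism I (fun x => pair2 (x 0 0) (x 0 1 - a (x 0 0))).
Proof.
move=> oI sa; exists (fun x => pair2 (x 0 0) (x 0 1 + a (x 0 0))).
have sNa : smooth_on I (fun t => - a t).
  apply: (@eq_smooth_on _ _ _ _ oI (fun t => -1 *: a t)).
    by move=> x _; exact: mulN1r.
  by apply: smooth_onZ => //; exact: smooth_on_cst.
split; [exact: smooth_on_strip_shear sNa|exact: smooth_on_strip_shear|].
move=> x Ix; rewrite /strip /= !mxE /=; split=> //.
  by rewrite subrK pair2_coord.
by rewrite addrK pair2_coord.
Qed.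

End Strip.

Lemma span2P (K : fieldType) (E : vectType K) (x y z : E) :
  reflect (exists a b : K, z = a *: x + b *: y) (z \in <<[:: x; y]>>%VS).
Proof.
rewrite span_cons span_seq1; apply: (iffP memv_addP).
  by move=> [_ /vlineP[a ->] [_ /vlineP[b ->] ->]]; exists a, b.
move=> [a [b ->]]; exists (a *: x); first by rewrite memvZ ?memv_line.
by exists (b *: y); rewrite ?memvZ ?memv_line.
Qed.

Theorem theorem2p17 (R : realType) (p : nat) (hp : (2 <= p)%N)
    (* a representative of the germ, on an open interval around 0 *)
    (I : set R) (Iopen : open I) (Iitv : is_interval I) (I0 : I 0)
    (f : R -> 'rV[R]_(1 + p)) (Tf : R -> {vspace 'rV[R]_(1 + p)})
    (f_lift : legendrian_lift 1 I f Tf)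
    (f_noinfl : forall t, I t -> ~ inflection_point I Tf t)
    (tau : R -> 'rV[R]_(1 + p)) (tau_frame : unit_frame I Tf tau)
    (F_frontal : frontal 2 (strip I) (Tan f tau))
    (F_proper : proper_map (strip I) (Tan f tau))
    (TF : 'rV[R]_2 -> {vspace 'rV[R]_(1 + p)})
    (F_lift : legendrian_lift 2 (strip I) (Tan f tau) TF)
    (mu : R -> 'rV[R]_(1 + p))
    (taumu_frame : orthonormal_tangent_frame I TF tau mu)
    (kappa : R -> R)
    (kappaE : forall t, I t -> derive1 tau t = kappa t *: mu t)
    (nu : 'I_(p - 1) -> R -> 'rV[R]_(1 + p))
    (nu_frame : normally_parallel_frame I TF nu)
    (ell : 'I_(p - 1) -> R -> R)
    (ellE : forall t, I t ->
       derive1 mu t = - kappa t *: tau t + \sum_(i < p - 1) ell i t *: nu i t)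
    (u : 'I_(p - 1) -> R) :
  exists (g : R -> 'rV[R]_(1 + p)) (Tg : R -> {vspace 'rV[R]_(1 + p)})
         (sigma : R -> 'rV[R]_(1 + p)),
    [/\ (forall t, I t ->
           g t = f t + \sum_(i < p - 1)
                         u i *: ((ell i t / kappa t) *: tau t + nu i t)),
        legendrian_lift 1 I g Tg,
        unit_frame I Tg sigma &
        right_equivalent I
          (Pal (fun x => \sum_(i < p - 1) u i *: nu i (x 0 0)) (Tan f tau))
          (Tan g sigma)].
Proof.
have [f_smooth Tf_smooth df_mem] := f_lift.
have [tau_smooth tauP] := tau_frame.
have [_ mu_smooth tmP] := taumu_frame.
have [nu_smooth nuP] := nu_frame.
have tauE t : I t -> 'D_1 tau t = kappa t *: mu t.
  by move=> It; rewrite -derive1E; exact: kappaE.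
(* At a zero of [kappa] the frame [tau] itself would witness an inflection point. *)
have kappa_neq0 t : I t -> kappa t != 0.
  move=> It; apply/eqP => k0; apply: (f_noinfl t It); exists tau; split => //.
  by rewrite kappaE // k0 scale0r.
have nu_orth i t w : I t -> w \in TF (pair2 t 0) -> dot (nu i t) w = 0.
  move=> It wT; have [_ nu_span _] := nuP t It.
  have : [set x | x \in <<codom (nu^~ t)>>%VS] (nu i t).
    by apply: memv_span; apply: codom_f.
  by rewrite -nu_span => /(_ w wT).
have tau_TF t : I t -> tau t \in TF (pair2 t 0).
  by move=> It; have [_ _ _ ->] := tmP t It; apply: memv_span; rewrite mem_head.
have mu_TF t : I t -> mu t \in TF (pair2 t 0).
  move=> It; have [_ _ _ ->] := tmP t It.
  by apply: memv_span; rewrite !inE eqxx orbT.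
(* Pairing the expansion of the derivative of [mu] with [nu i] kills the [tau] term, and
   orthonormality leaves one summand. *)
have dmu_nu i t : I t -> dot ('D_1 mu t) (nu i t) = ell i t.
  move=> It; have [nu_on _ _] := nuP t It.
  rewrite -derive1E ellE // dotDl dotZl dotC nu_orth ?tau_TF // mulr0 add0r dot_suml.
  rewrite (bigD1 i) //= big1 ?addr0.
    by rewrite dotZl (nu_on i i) eqxx mulr1.
  by move=> j ji; rewrite dotZl (nu_on j i) (negPf ji) mulr0.
(* [kappa] and [ell] are given only by pointwise equations; inner products of smooth curves recover
   them on [I]. *)
have kappa_smooth : smooth_on I kappa.
  apply: (eq_smooth_on Iopen (h := fun t => dot ('D_1 tau t) (mu t))) => //.
    move=> t It; have [_ mu1 _ _] := tmP t It.
    by rewrite tauE // dotZl mu1 mulr1.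
  by apply: smooth_on_dot => //; exact: smooth_on_derive.
have ell_smooth i : smooth_on I (ell i).
  apply: (eq_smooth_on Iopen (h := fun t => dot ('D_1 mu t) (nu i t))) => //.
    by move=> t It; rewrite dmu_nu.
  by apply: smooth_on_dot => //; exact: smooth_on_derive.
pose a t := \sum_(i < p - 1) u i * (ell i t / kappa t).
have a_smooth : smooth_on I a.
  apply: smooth_on_sum => // i; apply: smooth_onZ => //; first exact: smooth_on_cst.
  by apply: smooth_onZ => //; exact: smooth_onV.
pose w t := \sum_(i < p - 1) u i *: nu i t.
have w_smooth : smooth_on I w.
  apply: smooth_on_sum => // i; apply: smooth_onZ => //; exact: smooth_on_cst.
have atau_smooth : smooth_on I (fun t => a t *: tau t) by exact: smooth_onZ.
pose g t := f t + (a t *: tau t + w t).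
have g_smooth : smooth_on I g by apply: smooth_onD => //; exact: smooth_onD.
have dw t : I t -> 'D_1 w t = \sum_(i < p - 1) u i *: 'D_1 (nu i) t.
  move=> It; have dnu i : derivable (nu i) t 1 by exact: smooth_on_derivable It.
  have -> : w = \sum_(i < p - 1) (u i \*: nu i).
    by apply/funext => s; rewrite fct_sumE.
  rewrite derive_sum; last by move=> i; exact: derivableZ.
  by apply: eq_bigr => i _; rewrite deriveZ.
have dnu_mem i t : I t -> 'D_1 (nu i) t + ell i t *: mu t \in Tf t.
  move=> It; have [_ _ /(_ i)] := nuP t It; have [_ mu1 taumu0 ->] := tmP t It.
  rewrite derive1E => /span2P[c [d dnuE]].
  (* The product of [nu i] and [mu] vanishes on all of [I], hence near [t]. Expanding its derivative
     gives [d + ell i t = 0], so only the multiple [c] of [tau] survives. *)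
  have : 'D_1 (fun s => dot (nu i s) (mu s)) t = 0.
    rewrite -(derive_cst (0 : R) t 1); apply: near_eq_derive.
    have := open_nbhs_nbhs (conj Iopen It); apply: filterS => s Is /=.
    by rewrite nu_orth ?mu_TF.
  rewrite derive_dot; [|exact: smooth_on_derivable It..].
  rewrite [dot (nu i t) _]dotC dmu_nu // dnuE dotDl !dotZl taumu0 mu1.
  rewrite mulr0 add0r mulr1.
  move/eqP; rewrite addr_eq0 => /eqP ->.
  have [_ ->] := tauP t It.
  by rewrite scaleNr subrK memvZ ?memv_line.
have dg_mem t : I t -> 'D_1 g t \in Tf t.
  move=> It; have [_ TfE] := tauP t It.
  have df1 : derivable f t 1 by exact: smooth_on_derivable It.
  have da1 : derivable (fun t => a t *: tau t) t 1 by exact: smooth_on_derivable It.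
  have dw1 : derivable w t 1 by exact: smooth_on_derivable It.
  have -> : 'D_1 g t = 'D_1 f t + ('D_1 (fun t => a t *: tau t) t + 'D_1 w t).
    by rewrite -(deriveD da1 dw1) -(deriveD df1 (derivableD da1 dw1)).
  rewrite derive_scale; [|exact: smooth_on_differentiable It..].
  rewrite tauE // dw // memvD //.
    by rewrite deriveE ?df_mem //; exact: smooth_on_differentiable It.
  (* The term in the derivative of [a] is a multiple of [tau] and is split off; the [mu] term stays
     next to the derivative of [w]. *)
  rewrite addrAC memvD //; last by rewrite TfE memvZ ?memv_line.
  (* The division by [kappa] in [a] is undone here, so that the sum matches that of [dw] term by
     term and [dnu_mem] applies to each summand. *)
  have -> : a t *: (kappa t *: mu t) = \sum_(i < p - 1) u i *: (ell i t *: mu t).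
    rewrite scalerA mulr_suml scaler_suml; apply: eq_bigr => i _.
    by rewrite -mulrA divfK ?kappa_neq0 // scalerA.
  rewrite -big_split memv_suml // => i _ /=.
  by rewrite -scalerDr memvZ // addrC dnu_mem.
exists g, Tf, tau; split.
- move=> t It; rewrite /g /a /w scaler_suml -big_split; congr (_ + _).
  by apply: eq_bigr => i _; rewrite /= scalerDr scalerA.
- split; [exact: g_smooth | exact: Tf_smooth |] => t v It.
  (* On the line the differential is determined by its value at [1], which is the derivative of
     [g]. *)
  have -> : v = v *: (1 : R) by rewrite -[RHS]/(v * 1) mulr1.
  rewrite linearZ; apply: memvZ.
  by rewrite -(deriveE _ (smooth_on_differentiable g_smooth It)) dg_mem.
- exact: tau_frame.
(* As [g] already contains [a tau], the point [f + s tau + w] lies at parameter [s - a] on the line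
   through [g] directed by [tau]. *)
exists (fun x => pair2 (x 0 0) (x 0 1 - a (x 0 0))); split.
- exact: strip_diffeomorphism_shear.
- by move=> x _; rewrite mxE.
- move=> x _; rewrite /Pal /Tan /g -/(w _) !mxE /= scalerBl.
  rewrite -!addrA; congr (_ + _).
  by rewrite addrC [_ *: _ + (w _ + _)]addrC addrA subrK addrC.
Qed.
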